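(* Let $\mathbb{K}$ be a field and let $A\neq 0$ be a finite-dimensional non-degenerate evolution $\mathbb{K}$-algebra. Then the balance $\operatorname{b}(\Gamma(A,B))$ does not depend on the chosen natural basis $B$ of $A$; that is, $\operatorname{b}(\Gamma(A,B))=\operatorname{b}(\Gamma(A,B'))$ for any two natural bases $B,B'$ of $A$.
   Context: An evolution algebra over a field $\mathbb{K}$ is a (not necessarily associative) $\mathbb{K}$-algebra $A$ admitting a natural basis, i.e. a basis $B=\{e_1,\dots,e_n\}$ with $e_ie_j=0$ for $i\ne j$. Writing $e_i^2=\sum_k w_{ik}e_k$, the matrix $(w_{ik})$ is the structure matrix relative to $B$. $A$ is non-degenerate if it has a natural basis with $e_i^2\neq 0$ for all $i$ (equivalently $\{x\in A: xA=0\}=0$, so this is independent of the natural basis). The graph $\Gamma(A,B)$ is the directed graph on $\{1,\dots,n\}$ with an edge $(i,k)$ whenever $w_{ik}\ne 0$. A path in a directed graph is a sequence $(v_0,e_1,v_1,\dots,e_n,v_n)$, $n\ge 0$, of vertices and edges where each $e_i$ is traversed either forwards ($e_i=(v_{i-1},v_i)$) or backwards ($e_i=(v_i,v_{i-1})$); its balance is the number of forward steps minus the number of backward steps (a loop may be traversed in either direction, contributing $+1$ or $-1$ accordingly). A cycle is a path with $v_0=v_n$ (not necessarily simple). The balance $\operatorname{b}(\Gamma)$ of a graph $\Gamma$ is the gcd of the absolute values of the balances of all its cycles. *)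

(* Defs.v *)
From HB Require Import structures.
From mathcomp Require Import all_boot all_order all_algebra.
From mathcomp Require Import boolp classical_sets.

Set Implicit Arguments.
Unset Strict Implicit.
Unset Printing Implicit Defensive.

Import GRing.Theory.
Local Open Scope ring_scope.

Section EvolutionAlgebra.
Variables (K : fieldType) (A : vectType K).

(* A not necessarily associative, not necessarily unital, finite-dimensional
   K-algebra is a vectType A with a bilinear multiplication mul. *)
Variable mul : {bilinear A -> A -> A}.

Definition natural_basis (n : nat) (B : n.-tuple A) : Prop :=
  basis_of fullv B /\
  forall i j : 'I_n, i != j -> mul (tnth B i) (tnth B j) = 0.

Definition evolution_algebra : Prop :=
  exists (n : nat) (B : n.-tuple A), natural_basis B.

Definition nondegenerate_evolution : Prop :=
  exists (n : nat) (B : n.-tuple A),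
    natural_basis B /\ forall i : 'I_n, mul (tnth B i) (tnth B i) != 0.

Definition structure_matrix (n : nat) (B : n.-tuple A) : 'M[K]_n :=
  \matrix_(i, k) coord B k (mul (tnth B i) (tnth B i)).

Definition evolution_graph (n : nat) (B : n.-tuple A) : rel 'I_n :=
  fun i k => structure_matrix B i k != 0.

End EvolutionAlgebra.

Section GraphBalance.
Variables (V : eqType) (e : rel V).

(* A path (v_0, e_1, v_1, ..., e_n, v_n) is encoded by v_0 and the list of the
   pairs (d_i, v_i), where d_i is true when e_i = (v_{i-1}, v_i) is traversed
   forwards and false when e_i = (v_i, v_{i-1}) is traversed backwards. The
   edge e_i is determined by v_{i-1} and (d_i, v_i); a loop may be traversed
   with either value of d_i. *)
Fixpoint gpath (u : V) (p : seq (bool * V)) : bool :=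
  if p is (d, v) :: p' then (if d then e u v else e v u) && gpath v p'
  else true.

Definition gpath_end (u : V) (p : seq (bool * V)) : V := last u (unzip2 p).

Definition gcycle (u : V) (p : seq (bool * V)) : bool :=
  gpath u p && (gpath_end u p == u).

Definition path_balance (p : seq (bool * V)) : int :=
  (count (fun s => s.1) p)%:Z - (count (fun s => ~~ s.1) p)%:Z.

Definition cycle_balances : set nat :=
  [set m | exists u p, gcycle u p /\ m = `|path_balance p|%N]%classic.

End GraphBalance.

(* The gcd of a possibly infinite set of naturals; it is 0 when S is contained
   in {0}. *)
Definition is_gcd_set (S : set nat) (d : nat) : Prop :=
  (forall m, S m -> (d %| m)%N) /\
  (forall c, (forall m, S m -> (c %| m)%N) -> (c %| d)%N).

Definition gcd_set (S : set nat) : nat := xget 0%N (is_gcd_set S).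

Lemma is_gcd_set_uniq (S : set nat) (d d' : nat) :
  is_gcd_set S d -> is_gcd_set S d' -> d = d'.
Proof.
move=> [dS dmax] [d'S d'max]; apply/eqP; rewrite eqn_dvd.
by apply/andP; split; [apply: d'max | apply: dmax].
Qed.

Lemma is_gcd_set_ex (S : set nat) : exists d, is_gcd_set S d.
Proof.
case: (pselect (exists2 x, S x & (0 < x)%N)) => [[x Sx x0]|S0]; last first.
  exists 0%N; split=> [m Sm|c _]; last exact: dvdn0.
  case: m Sm => [//|m] Sm; by exfalso; apply: S0; exists m.+1.
(* G d: d is positive and every common divisor of S divides it; the gcd is the
   least such d. *)
pose G d := `[< (0 < d)%N /\
  forall c, (forall m, S m -> (c %| m)%N) -> (c %| d)%N >].
have exG : exists d, G d by exists x; apply/asboolP; split=> // c; exact.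
case: (ex_minnP exG) => d /asboolP[d0 dmax] dmin.
exists d; split=> // m Sm.
have Gg : G (gcdn d m).
  apply/asboolP; split; first by rewrite gcdn_gt0 d0.
  by move=> c cS; rewrite dvdn_gcd (dmax _ cS) (cS _ Sm).
have dE : d = gcdn d m.
  by apply/eqP; rewrite eqn_leq dmin // dvdn_leq // dvdn_gcdl.
by rewrite dE dvdn_gcdr.
Qed.

Lemma gcd_setP (S : set nat) : is_gcd_set S (gcd_set S).
Proof. exact: (xgetPex 0%N (is_gcd_set_ex S)). Qed.

Definition graph_balance (V : eqType) (e : rel V) : nat :=
  gcd_set (cycle_balances e).

(* Main.v *)
(* Expanding e_i e'_j in either of two natural bases B = (e_i), B' = (e'_j)
   gives a *: e_i^2 = b *: e'_j^2, where a is the coordinate of e'_j at e_i and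
   b that of e_i at e'_j. By non-degeneracy all squares are nonzero, so a and b
   vanish simultaneously, and if they do not, then e_i^2 and e'_j^2 are
   parallel: i and j have "the same out-neighbours". This makes it possible to
   lift paths of Gamma(A, B') to paths of Gamma(A, B) of the same balance, where
   two lifts of one vertex are joined by a zigzag i -> x <- k of balance 0. So
   even the sets of cycle balances of the two graphs coincide. *)
Require Import Defs.
From HB Require Import structures.
From mathcomp Require Import all_boot all_order all_algebra.
From mathcomp Require Import classical_sets.

Set Implicit Arguments.
Unset Strict Implicit.
Unset Printing Implicit Defensive.

Import GRing.Theory.
Local Open Scope ring_scope.

Lemma path_balance_cons (V : eqType) (d : bool) (v : V) (p : seq (bool * V)) :
  path_balance ((d, v) :: p) = (if d then 1 else -1) + path_balance p.
Proof.
rewrite /path_balance /=; case: d; rewrite /= add0n PoszD.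
  by rewrite addrA.
by rewrite opprD addrCA.
Qed.

Section PathLifting.
Variables (V V' : eqType) (e : rel V) (e' : rel V') (R : V -> V' -> Prop).
Hypothesis Rsurj : forall j, exists i, R i j.
Hypothesis Rzigzag : forall i k j, R i j -> R k j -> exists x, e i x /\ e k x.
Hypothesis Rlift : forall i j l, R i j -> e' j l -> exists k, R k l /\ e i k.

Lemma path_lifting (p' : seq (bool * V')) (j : V') (i k : V) :
    gpath e' j p' -> R i j -> R k (gpath_end j p') ->
  exists p, [/\ gpath e i p, gpath_end i p = k
              & path_balance p = path_balance p'].
Proof.
elim: p' j i => [|[d l] p' IH] j i.
  (* The end [k] is prescribed, so even the empty path may need a zigzag from [i] to [k]. *)
  move=> _ Rij Rkj; have [x [eix ekx]] := Rzigzag Rij Rkj.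
  by exists [:: (true, x); (false, k)]; rewrite /= eix ekx.
case: d => /= /andP[jl lp'] Rij Rk.
  have [m [Rml eim]] := Rlift Rij jl.
  have [p [mp pk bp]] := IH _ _ lp' Rml Rk.
  by exists ((true, m) :: p); rewrite /= eim !path_balance_cons bp.
(* The edge runs from [l] to [j], so it is lifted from a lift [m] of [l]. It ends at some lift [i2]
   of [j], perhaps not [i]; a zigzag joins the two. *)
have [m Rml] := Rsurj l.
have [i2 [Ri2 emi2]] := Rlift Rml jl.
have [x [eix ei2x]] := Rzigzag Rij Ri2.
have [p [mp pk bp]] := IH _ _ lp' Rml Rk.
exists [:: (true, x), (false, i2), (false, m) & p].
by rewrite /= eix ei2x emi2 !path_balance_cons bp addNKr.
Qed.

Lemma cycle_balances_lifting :
  (cycle_balances e' `<=` cycle_balances e)%classic.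
Proof.
move=> m [j [p' [/andP[jp' /eqP jj] ->]]].
have [i Rij] := Rsurj j.
(* Prescribing the same lift at both ends makes the lifted path a cycle. *)
have Rend : R i (gpath_end j p') by rewrite jj.
have [p [ip pi bp]] := path_lifting jp' Rij Rend.
by exists i, p; rewrite /gcycle ip pi eqxx bp.
Qed.

End PathLifting.

Section NaturalBases.
Variables (K : fieldType) (A : vectType K) (mul : {bilinear A -> A -> A}).

Lemma coord_full_sum (n : nat) (B : n.-tuple A) (x : A) :
  basis_of fullv B -> x = \sum_i coord B i x *: tnth B i.
Proof.
move=> bB; rewrite {1}(coord_basis bB (memvf x)).
by apply: eq_bigr => i _; rewrite (tnth_nth 0).
Qed.

Lemma coord_full_eq0 (n : nat) (B : n.-tuple A) (x : A) :
  basis_of fullv B -> x != 0 -> exists i, coord B i x != 0.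
Proof.
move=> bB x0; apply/existsP; apply: contraNT x0; rewrite negb_exists.
move=> /forallP c0; rewrite (coord_full_sum x bB) big1// => i _.
by have /negbNE/eqP -> := c0 i; rewrite scale0r.
Qed.

Lemma natural_basis_mull (n : nat) (B : n.-tuple A) (i : 'I_n) (x : A) :
    natural_basis mul B ->
  mul (tnth B i) x = coord B i x *: mul (tnth B i) (tnth B i).
Proof.
move=> [bB oB]; rewrite {1}(coord_full_sum x bB) linear_sumr (bigD1 i)//=.
rewrite big1 ?addr0 ?linearZr_LR// => k ki.
by rewrite linearZr_LR /= oB ?scaler0// eq_sym.
Qed.

Lemma natural_basis_mulr (n : nat) (B : n.-tuple A) (i : 'I_n) (x : A) :
    natural_basis mul B ->
  mul x (tnth B i) = coord B i x *: mul (tnth B i) (tnth B i).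
Proof.
move=> [bB oB]; rewrite {1}(coord_full_sum x bB) linear_sumlz (bigD1 i)//=.
rewrite big1 ?addr0 ?linearZl_LR// => k ki.
by rewrite linearZl_LR /= oB ?scaler0.
Qed.

(** A basis vector of square zero would annihilate [A], yet its product with some vector of the
    non-degenerate basis [C] is a nonzero multiple of a nonzero square. *)
Lemma nondegenerate_square_neq0 (n : nat) (B : n.-tuple A) (i : 'I_n) :
    nondegenerate_evolution mul -> natural_basis mul B ->
  mul (tnth B i) (tnth B i) != 0.
Proof.
move=> [m [C [natC sqC]]] natB.
have bi0 := free_not0 (basis_free natB.1) (mem_tnth i B).
have [j cj] := coord_full_eq0 natC.1 bi0.
apply: contraNneq cj => sq0.
have := natural_basis_mulr j (tnth B i) natC.
rewrite natural_basis_mull// sq0 scaler0 => /esym/eqP.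
by rewrite scaler_eq0 (negbTE (sqC j)) orbF.
Qed.

Lemma natural_bases_cycle_balances (n n' : nat)
    (B : n.-tuple A) (B' : n'.-tuple A) :
    nondegenerate_evolution mul ->
    natural_basis mul B -> natural_basis mul B' ->
  (cycle_balances (evolution_graph mul B') `<=`
   cycle_balances (evolution_graph mul B))%classic.
Proof.
move=> nd natB natB'.
have sqB i := nondegenerate_square_neq0 i nd natB.
have sqB' j := nondegenerate_square_neq0 j nd natB'.
have E i j : coord B i (tnth B' j) *: mul (tnth B i) (tnth B i)
    = coord B' j (tnth B i) *: mul (tnth B' j) (tnth B' j).
  by rewrite -natural_basis_mull// -natural_basis_mulr.
have coordC i j : (coord B i (tnth B' j) != 0) = (coord B' j (tnth B i) != 0).
  have := congr1 (fun x => x == 0) (E i j).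
  by rewrite /= !scaler_eq0 (negbTE (sqB i)) (negbTE (sqB' j)) !orbF => ->.
(* The functional [f] will be a coordinate in [B] for zigzags and in [B'] for lifting edges. *)
have parallel i j (f : {linear A -> K^o}) : coord B' j (tnth B i) != 0 ->
    (f (mul (tnth B i) (tnth B i)) != 0) =
    (f (mul (tnth B' j) (tnth B' j)) != 0).
  move=> c'; have c : coord B i (tnth B' j) != 0 by rewrite coordC.
  have := congr1 (fun x => f x == 0) (E i j).
  by rewrite /= !linearZ /= !scaler_eq0 (negbTE c) (negbTE c') /= => ->.
apply: (@cycle_balances_lifting _ _ _ _
  (fun i j => coord B' j (tnth B i) != 0)).
- move=> j; have [i ci] : exists i, coord B i (tnth B' j) != 0.
    apply: coord_full_eq0 natB.1 _; apply: contraNneq (sqB' j) => ->.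
    by rewrite linear0r.
  by exists i; rewrite -coordC.
- move=> i k j ci ck.
  (* Any [x] in the support of the square of [tnth B' j] serves: the squares at [i] and [k] are both
     parallel to it. *)
  have [x cx] := coord_full_eq0 natB.1 (sqB' j).
  by exists x; rewrite /evolution_graph !mxE !(parallel _ j).
- move=> i j l ci; rewrite /evolution_graph mxE -(parallel i)// => cl.
  (* Expand the square of [tnth B i] in [B]: its coordinate at [l] is nonzero, so some term
     contributes to it, and the index of that term is the lift of [l]. *)
  have /existsP[k /andP[ck cik]] : [exists k, (coord B' l (tnth B k) != 0) &&
      (coord B k (mul (tnth B i) (tnth B i)) != 0)].
    apply: contraNT cl; rewrite negb_exists => /forallP c0.
    rewrite (coord_full_sum (mul (tnth B i) (tnth B i)) natB.1).
    rewrite linear_sum big1// => k _; rewrite linearZ /=.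
    have := c0 k; rewrite negb_and !negbK => /orP[] /eqP ->.
      by rewrite scaler0.
    by rewrite scale0r.
  by exists k; rewrite mxE.
Qed.

End NaturalBases.

Theorem theorem6p1 (K : fieldType) (A : vectType K)
    (mul : {bilinear A -> A -> A})
    (A_neq0 : (0 < \dim {:A})%N)
    (A_evol : evolution_algebra mul)
    (A_nondeg : nondegenerate_evolution mul)
    (n n' : nat) (B : n.-tuple A) (B' : n'.-tuple A)
    (natB : natural_basis mul B) (natB' : natural_basis mul B') :
  graph_balance (evolution_graph mul B) =
  graph_balance (evolution_graph mul B').
Proof.
congr gcd_set; apply/seteqP.
by split; apply: natural_bases_cycle_balances.
Qed.
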